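(* Let $\mathcal{T}\subseteq\mathcal{S}$ be a (nonempty) follower sample. For $s\in\mathcal{S}\setminus\mathcal{T}$ let $\nu(s)\in\mathcal{T}$ be the follower whose feature vector is the nearest neighbor of $\mathbf{f}^s$ in $\{\mathbf{f}^t\}_{t\in\mathcal{T}}$, and let $m^t_{1,\mathcal{S}\setminus\mathcal{T}}=\sum_{s\in\mathcal{S}\setminus\mathcal{T}}\mathbf{1}[\nu(s)=t]$ for $t\in\mathcal{T}$. Let $\mathbf{x}^{\mathrm{PR}}_{\mathcal{T}}$ be the ($\mathbf{x}$-component of the) optimal solution to the parametric regression-augmented problem $$\min_{\mathbf{x}\in\mathcal{X},\,\boldsymbol{\theta}\in\Theta}\left\{f(\mathbf{x})+\sum_{t\in\mathcal{T}}q^tG^t(\mathbf{x})+\sum_{s\in\mathcal{S}\setminus\mathcal{T}}q^sP(\mathbf{f}^s;\boldsymbol{\theta})\ \middle|\ \sum_{t\in\mathcal{T}}m^t_{1,\mathcal{S}\setminus\mathcal{T}}\left|G^t(\mathbf{x})-P(\mathbf{f}^t;\boldsymbol{\theta})\right|\le\bar L\right\}.$$ If Assumptions (A1) (independence), (A2) (Lipschitz expected cost) and (A3) (Lipschitz prediction model), as stated in the context, hold, then for $\gamma\in(0,1]$, with probability at least $1-\gamma$, $$F(\mathbf{x}^{\mathrm{PR}}_{\mathcal{T}})-F(\mathbf{x}^* )\le E_m^{\mathrm{PR}}(\mathcal{T},\bar L),$$ where $$E_m^{\mathrm{PR}}(\mathcal{T},\bar L)=2\bar Q\bar L\,\mathbf{1}(\mathcal{T}\subset\mathcal{S})+2\bar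 Q(\lambda+\mu)\sum_{s\in\mathcal{S}\setminus\mathcal{T}}d_{\mathcal{F}}(\mathbf{f}^s,\mathbf{f}^{\nu(s)})+\sqrt{4\bar Q^2\bar G^2\left[|\mathcal{S}\setminus\mathcal{T}|+\sum_{t\in\mathcal{T}}(m^t_{1,\mathcal{S}\setminus\mathcal{T}})^2\right]\log(1/\gamma)}.$$
   Context: Bilevel problem. $\mathcal{X}\subseteq\mathbb{R}^{n_1}$ is the bounded, closed feasible set of the leader and $f:\mathbb{R}^{n_1}\to\mathbb{R}$ is the leader's cost. $\mathcal{S}$ is a finite set of $m$ followers; follower $s$ has weight $q^s\ge 0$, objective $h^s:\mathbb{R}^{n_1+n_2}\to\mathbb{R}$ and non-empty feasible set $\mathcal{Y}^s(\mathbf{x})\subseteq\mathbb{R}^{n_2}$ depending on the leader's decision $\mathbf{x}$; $g:\mathbb{R}^{n_1+n_2}\to\mathbb{R}_+$ measures the cost of a follower's decision. The cost of follower $s$ is $$G^s(\mathbf{x})=\min_{\mathbf{y}^s}\{g(\mathbf{x},\mathbf{y}^s):\mathbf{y}^s\in\arg\min_{\mathbf{y}\in\mathcal{Y}^s(\mathbf{x})}h^s(\mathbf{x},\mathbf{y})\}.$$ The original objective is $F(\mathbf{x})=f(\mathbf{x})+\sum_{s\in\mathcal{S}}q^sG^s(\mathbf{x})$, and $\mathbf{x}^*\in\arg\min_{\mathbf{x}\in\mathcal{X}}F(\mathbf{x})$ is an optimal solution. $\bar G\in\mathbb{R}_+$ is a constant with $0\le G^s(\mathbf{x})\le\bar G$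 for all $s\in\mathcal{S}$, $\mathbf{x}\in\mathcal{X}$. $\bar Q=\max_{s\in\mathcal{S}\setminus\mathcal{T}}q^s$ (read as $0$ if $\mathcal{T}=\mathcal{S}$). Features and probabilistic model. Each follower $s$ has a feature vector $\mathbf{f}^s$ in a feature space $\mathcal{F}\subseteq\mathbb{R}^\xi$ equipped with a distance metric $d_{\mathcal{F}}$; nearest neighbors are taken with respect to $d_{\mathcal{F}}$. For each fixed $\mathbf{x}$, the cost $G^s(\mathbf{x})$ is regarded as a random variable with probability density $\eta_{\mathbf{x}}(\cdot\mid\mathbf{f}^s)$ given the feature vector $\mathbf{f}^s$; probabilities are with respect to this randomness. $P(\cdot;\boldsymbol{\theta}):\mathbb{R}^\xi\to\mathbb{R}$ is a parametric regression model with parameters $\boldsymbol{\theta}\in\Theta$, and $\bar L\in\mathbb{R}_+$ is a user-defined upper bound on the training loss. $\mathbf{1}(\cdot)$ is the indicator function, and $\mathcal{T}\subset\mathcal{S}$ means proper inclusion. Assumption (A1). For any followers $s,s'\in\mathcal{S}$, $s\ne s'$, and any leader decisions $\mathbf{x}_1,\mathbf{x}_2\in\mathcal{X}$, the target random variables with distributions $\eta_{\mathbf{x}_1}(\cdot\mid\mathbf{f}^s)$ and $\eta_{\mathbf{x}_2}(\cdot\mid\mathbf{f}^{s'})$ are independent. Assumption (A2). There exists a constant $\mu\in\mathbb{R}_+$ such that, for any fixed $\mathbf{x}\in\mathcal{X}$, the function $\mathbf{f}\mapsto\mathbb{E}_{G\sim\eta_{\mathbf{x}}(\cdot\mid\mathbf{f})}[G\mid\mathbf{f}]$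 is $\mu$-Lipschitz continuous with respect to $\mathbf{f}$ (distances measured by $d_{\mathcal{F}}$). Assumption (A3). There exists a constant $\lambda\in\mathbb{R}_+$ such that, for any fixed $\boldsymbol{\theta}\in\Theta$, the function $\mathbf{f}\mapsto P(\mathbf{f};\boldsymbol{\theta})$ is $\lambda$-Lipschitz continuous with respect to $\mathbf{f}$ (distances measured by $d_{\mathcal{F}}$).
   Formalization: The formal theorem takes (A1) as mutual independence across followers, treats x^PR and x* as fixed decisions (bound asserted where they are optimal for the realized costs), and assumes x* satisfies the training-loss constraint for some θ; the literal claim fails without these. *)

(* Defs.v *)
From HB Require Import structures.
From mathcomp Require Import all_boot all_order all_algebra.
From mathcomp Require Import all_classical all_reals all_analysis.
Import Order.TTheory GRing.Theory Num.Theory.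
Import numFieldNormedType.Exports.

Set Implicit Arguments.
Unset Strict Implicit.
Unset Printing Implicit Defensive.

Local Open Scope classical_set_scope.
Local Open Scope ring_scope.

Section Optimization.
Context {R : realType}.

Definition is_minimum (A : set R) (v : R) : Prop := A v /\ lbound A v.

Definition argmin {U : Type} (D : set U) (c : U -> R) : set U :=
  [set u | D u /\ forall u', D u' -> c u <= c u'].

(* [v] is G^s(x): among the optimal responses of a follower with feasible set
   [Y x] and objective [h], the least value of [g] (optimistic convention).
   The minimum is required to be attained. *)
Definition is_follower_cost {n1 n2 : nat} (g h : 'rV[R]_(n1 + n2) -> R)
    (Y : 'rV[R]_n1 -> set 'rV[R]_n2) (x : 'rV[R]_n1) (v : R) : Prop :=
  is_minimum
    [set g (row_mx x y) | y in argmin (Y x) (fun y => h (row_mx x y))] v.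

End Optimization.

Section Features.
Context {R : realType}.

Definition is_metric_on {V : Type} (D : set V) (d : V -> V -> R) : Prop :=
  [/\ forall u v, D u -> D v -> 0 <= d u v,
      forall u v, D u -> D v -> (d u v = 0 <-> u = v),
      forall u v, D u -> D v -> d u v = d v u
    & forall u v w, D u -> D v -> D w -> d u w <= d u v + d v w].

Definition is_nearest_neighbor {V : Type} {S : finType} (d : V -> V -> R)
    (phi : S -> V) (T : {set S}) (nu : S -> S) : Prop :=
  forall s, s \notin T ->
    nu s \in T /\ forall t, t \in T -> d (phi s) (phi (nu s)) <= d (phi s) (phi t).

Definition lipschitz_wrt {V : Type} (D : set V) (d : V -> V -> R) (k : R)
    (p : V -> R) : Prop :=
  forall u v, D u -> D v -> `|p u - p v| <= k * d u v.

(* Extended-real version; taking [u = v] shows that it forces [p] to be finite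
   on [D] when [d] is a metric on [D], because [+oo - +oo] is [-oo]. *)
Definition elipschitz_wrt {V : Type} (D : set V) (d : V -> V -> R) (k : R)
    (p : V -> \bar R) : Prop :=
  forall u v, D u -> D v -> (`|p u - p v| <= (k * d u v)%:E)%E.

End Features.

Section Probability.
Context {R : realType}.

Definition is_density (e : R -> R) : Prop :=
  [/\ measurable_fun setT e, forall y, 0 <= e y
    & (\int[lebesgue_measure]_(y in setT) (e y)%:E = 1)%E].

Definition density_mean (e : R -> R) : \bar R :=
  (\int[lebesgue_measure]_(y in setT) (y * e y)%:E)%E.

Context {d : measure_display} {Omega : measurableType d}.
Variable P : probability Omega R.

Definition has_density (Z : {RV P >-> R}) (e : R -> R) : Prop :=
  forall A : set R, measurable A ->
    distribution P Z A = (\int[lebesgue_measure]_(y in A) (e y)%:E)%E.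

Definition mutually_independent {I : finType} (Z : I -> {RV P >-> R}) : Prop :=
  forall (J : {set I}) (A : I -> set R), (forall i, measurable (A i)) ->
    P (\bigcap_(i in [set i | i \in J]) (Z i @^-1` A i)) =
    (\prod_(i in J) P (Z i @^-1` A i))%E.

(* [Q] need not be measurable: it only has to contain an event of probability
   at least [p]. *)
Definition with_probability_at_least (p : R) (Q : set Omega) : Prop :=
  exists A : set Omega, [/\ measurable A, (p%:E <= P A)%E & A `<=` Q].

End Probability.

Section Regression.
Context {R : realType} {n1 xi : nat} {S : finType} {Par : Type}.

Definition original_objective (f : 'rV[R]_n1 -> R) (q : S -> R)
    (G : S -> 'rV[R]_n1 -> R) (x : 'rV[R]_n1) : R :=
  f x + \sum_(s : S) q s * G s x.

(* Number of followers outside [T] whose nearest neighbor is [t]. *)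
Definition assigned (T : {set S}) (nu : S -> S) (t : S) : nat :=
  \sum_(s in ~: T) (nu s == t).

Variables (f : 'rV[R]_n1 -> R) (q : S -> R) (phi : S -> 'rV[R]_xi)
  (T : {set S}) (nu : S -> S) (M : 'rV[R]_xi -> Par -> R).

Definition pr_objective (G : S -> 'rV[R]_n1 -> R) (z : 'rV[R]_n1 * Par) : R :=
  f z.1 + \sum_(t in T) q t * G t z.1
        + \sum_(s in ~: T) q s * M (phi s) z.2.

Definition training_loss (G : S -> 'rV[R]_n1 -> R) (z : 'rV[R]_n1 * Par) : R :=
  \sum_(t in T) (assigned T nu t)%:R * `|G t z.1 - M (phi t) z.2|.

Definition pr_feasible (X : set 'rV[R]_n1) (Theta : set Par) (Lbar : R)
    (G : S -> 'rV[R]_n1 -> R) : set ('rV[R]_n1 * Par) :=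
  [set z | [/\ X z.1, Theta z.2 & training_loss G z <= Lbar]].

Definition pr_solution (X : set 'rV[R]_n1) (Theta : set Par) (Lbar : R)
    (G : S -> 'rV[R]_n1 -> R) : set 'rV[R]_n1 :=
  [set x | exists theta,
     argmin (pr_feasible X Theta Lbar G) (pr_objective G) (x, theta)].

(* The weights are nonnegative, so taking 0 as the base value of the maximum
   only matters when [T] contains all the followers. *)
Definition Qbar : R := \big[Num.max/0]_(s in ~: T) q s.

Definition pr_bound (dF : 'rV[R]_xi -> 'rV[R]_xi -> R)
    (lambda mu Lbar Gbar gamma : R) : R :=
  2 * Qbar * Lbar * (T \proper [set: S])%:R
  + 2 * Qbar * (lambda + mu) * (\sum_(s in ~: T) dF (phi s) (phi (nu s)))
  + Num.sqrt (4 * Qbar ^+ 2 * Gbar ^+ 2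
              * (#|~: T|%:R + \sum_(t in T) (assigned T nu t)%:R ^+ 2)
              * ln (1 / gamma)).

End Regression.

(* Main.v *)
Require Import Defs.
From HB Require Import structures.
From mathcomp Require Import all_boot all_order all_algebra.
From mathcomp Require Import all_classical all_reals all_analysis.
From mathcomp Require Import measurable_realfun.
From mathcomp Require Import ring lra.
Import Order.TTheory GRing.Theory Num.Theory.
Import numFieldNormedType.Exports.

Set Implicit Arguments.
Unset Strict Implicit.
Unset Printing Implicit Defensive.

Local Open Scope classical_set_scope.
Local Open Scope ring_scope.

(** The excess cost splits into a deterministic part and a fluctuation.

    Writing [a s = q s] for [s] outside [T], and [a t = - sum of the q s whose
    nearest neighbor is t] for [t] in [T], the prediction error
    [\sum_(s in ~: T) q s * (G s x - M (phi s) theta)] of a feasible pair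
    [(x, theta)] differs from the centered sum
    [\sum_s a s * (G s x - E (G s x))] by at most
    [Qbar * Lbar + Qbar * (lambda + mu) * \sum_(s in ~: T) d(s, nu s)]
    ([regression_gap_le]): the difference is the sum over [s] outside [T] of
    [q s] times the variation of the mean from [s] to [nu s], plus the
    training error at [nu s], plus the variation of the model from [nu s] to
    [s]. Since the regression solution does at least as well as
    [(xopt, theta)] for the surrogate objective, [F xPR - F xopt] is at most
    the prediction error at [xPR] minus the one at [xopt], hence at most twice
    that quantity plus the difference [D1 - D2] of the two centered sums.

    For a fixed decision the costs of the followers are independent and lie
    in [[0, Gbar]], so Hoeffding's lemma bounds the moment generating function
    of each centered sum at [t] by [exp (t^2 V / 8)] where
    [V = Gbar^2 * \sum_s a s ^ 2] ([hoeffding_sum_mgf_le]). Nothing is known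
    about the joint law of [D1] and [D2], which involve the same followers at
    two decisions; but [exp (t (D1 - D2))] is at most the average of
    [exp (2 t D1)] and [exp (- 2 t D2)], which yields the bound
    [exp (t^2 V / 2)] without any joint independence, and Chernoff's bound
    then gives [D1 - D2 <= sqrt (2 V log (1 / gamma))] with probability at
    least [1 - gamma] ([hoeffding_diff_tail]). As
    [V <= Qbar^2 Gbar^2 (#|~: T| + \sum_(t in T) m_t ^ 2)], this is within the
    stated bound, whose factor 4 is twice the one needed.

    Two facts are obtained from equality of measures by approximation with
    simple functions ([ge0_integral_comp_weight]): the expectation of a
    product of functions of independent variables is the product of the
    expectations, and the mean of a density is the expectation of any
    variable that has this density. *)

(** * Exponential inequalities *)

Lemma mvt_from0 (R : realType) (f df : R -> R) (u : R) :
  (forall x : R, is_derive x 1 f (df x)) ->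
  exists c, 0 <= c * u /\ f u = f 0 + df c * u.
Proof.
move=> fdf.
have cf (a b : R) : {within `[a, b], continuous f}.
  by apply: derivable_within_continuous => x _; have [] := fdf x.
have [u0|u0|<-] := ltgtP 0 u.
- have [c] := MVT u0 (fun x _ => fdf x) (cf 0 u).
  rewrite in_itv/= => /andP[c0 cu] e; exists c; split.
    by rewrite mulr_ge0 ?(ltW c0) ?(ltW u0).
  by rewrite -[u in df c * u]subr0 -e; ring.
- have [c] := MVT u0 (fun x _ => fdf x) (cf u 0).
  rewrite in_itv/= => /andP[c0 cu] e; exists c; split.
    by rewrite mulr_le0 ?(ltW c0) ?(ltW u0) ?(ltW cu).
  by have -> : df c * u = - (df c * (0 - u)); [ring|rewrite -e; ring].
- by exists 0; rewrite !mulr0 addr0.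
Qed.

(** The two-point case of Hoeffding's lemma: the function [psi] below, the
    quotient of the two sides, has derivative [psi * k] where [k] vanishes at 0
    and is nonincreasing, so that [psi] is maximal at 0. *)
Lemma bernoulli_mgf_le (R : realType) (p u : R) : 0 <= p <= 1 ->
  1 - p + p * expR u <= expR (p * u + u ^+ 2 / 8).
Proof.
move=> /andP[p0 p1].
pose D (x : R) : R := 1 - p + p * expR x.
have Dgt0 x : 0 < D x.
  rewrite /D; have e0 := expR_gt0 x.
  have [->|pn0] := eqVneq p 0; first by rewrite mul0r subr0 addr0.
  have pgt0 : 0 < p by rewrite lt_neqAle eq_sym pn0.
  by rewrite ltr_wpDl ?subr_ge0// mulr_gt0.
pose k (x : R) : R := 1 - p - (1 - p) / D x - x / 4.
pose dk (x : R) : R := (1 - p) * (p * expR x) / D x ^+ 2 - 1 / 4.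
have dkP (x : R) : is_derive x 1 k (dk x).
  have Dn0 : D x != 0 by rewrite gt_eqF.
  have dD : is_derive x 1 D (p * expR x).
    by rewrite /D; apply: is_derive_eq; rewrite -?[_ *: _]/(_ * _); ring.
  have dV := @is_deriveV R D x _ 1 Dn0 dD.
  rewrite /k; apply: is_derive_eq; rewrite -?[_ *: _]/(_ * _).
  by rewrite /dk -?[_ *: _]/(_ * _); field.
(* The product of the two numbers [1 - p] and [p * expR x] is at most a quarter
   of the square of their sum [D x]. *)
have dk_le0 x : dk x <= 0.
  rewrite /dk subr_le0 ler_pdivrMr ?exprn_gt0// /D.
  have := sqr_ge0 ((1 - p) - p * expR x); set y := p * expR x.
  by move=> h; rewrite -subr_ge0; lra.
have k0 : k 0 = 0 by rewrite /k /D expR0; field; lra.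
have kx x : k x * x <= 0.
  have [c [_ ->]] := mvt_from0 x dkP.
  by rewrite k0 add0r -mulrA mulr_le0_ge0 ?dk_le0// -expr2 sqr_ge0.
pose psi (x : R) : R := expR (- (p * x + x ^+ 2 / 8)) * D x.
pose dpsi (x : R) : R := expR (- (p * x + x ^+ 2 / 8)) * D x * k x.
have dpsiP (x : R) : is_derive x 1 psi (dpsi x).
  have dD : is_derive x 1 D (p * expR x).
    by rewrite /D; apply: is_derive_eq; rewrite -?[_ *: _]/(_ * _); ring.
  have dE : is_derive x 1 (fun x : R => - (p * x + x ^+ 2 / 8)) (- (p + x / 4)).
    apply: is_derive_eq; rewrite -?[_ *: _]/(_ * _) -?[_ *+ _]/(_ * _).
    by field.
  have dX := @is_derive1_comp R expR (fun x : R => - (p * x + x ^+ 2 / 8)) x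
    _ _ (is_derive_expR _) dE.
  have Dn0 : D x != 0 by rewrite gt_eqF.
  apply: (@is_derive_eq _ _ _ _ _ _ _ _ (is_deriveM dX dD)).
  rewrite /dpsi /k /= -![_ *: _]/(_ * _); set e := expR (- _).
  have Dx : p * expR x = D x - (1 - p) by rewrite /D; ring.
  by rewrite Dx; field.
have : psi u <= 1.
  have [c [cu ->]] := mvt_from0 u dpsiP.
  have -> : psi 0 = 1.
    by rewrite /psi /D !(mulr0, expr0n, mul0r, addr0, oppr0, expR0); ring.
  rewrite gerDl /dpsi -mulrA mulr_ge0_le0//.
    by rewrite mulr_ge0 ?expR_ge0 ?ltW.
  have [->|c0] := eqVneq c 0; first by rewrite k0 mul0r.
  have -> : k c * u = (k c * c) * (c * u) / c ^+ 2 by field.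
  by rewrite mulr_le0_ge0 ?invr_ge0 ?sqr_ge0// mulr_le0_ge0.
rewrite /psi expRN -[in X in X -> _](mulrC (D u)).
by rewrite ler_pdivrMr ?expR_gt0// mul1r.
Qed.

(** Convexity of the exponential between 0 and [a]. *)
Lemma expR_chord_le (R : realType) (t a : R) : 0 <= t <= 1 ->
  expR (t * a) <= 1 - t + t * expR a.
Proof.
move=> /andP[t0 t1].
(* Both ends of the chord lie above the tangent at [t * a]. *)
have h0 := ler_wpM2l (expR_ge0 (t * a)) (expR_ge1Dx (- (t * a))).
have h1 := ler_wpM2l (expR_ge0 (t * a)) (expR_ge1Dx ((1 - t) * a)).
rewrite -expRD subrr expR0 in h0.
rewrite -expRD -mulrDl (addrC t) subrK mul1r in h1.
have {}h1 := ler_wpM2l t0 h1.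
have {}h0 : (1 - t) * (expR (t * a) * (1 + - (t * a))) <= (1 - t) * 1.
  by apply: ler_wpM2l => //; rewrite subr_ge0.
lra.
Qed.

(** * Integrals against weighted measures *)

Section weighted_integrals.
Import HBNNSimple.

Lemma integral_nnsfun_comp d (T : measurableType d) (R : realType)
    (m : {measure set T -> \bar R}) (Z : {mfun T >-> R}) (W : T -> R)
    (psi : {nnsfun R >-> R}) :
  measurable_fun [set: T] W -> (forall x, 0 <= W x) ->
  (\int[m]_x (psi (Z x) * W x)%:E =
   \sum_(k \in range psi)
     k%:E * \int[m]_(x in Z @^-1` (psi @^-1` [set k])) (W x)%:E)%E.
Proof.
move=> mW W0.
have mA (k : R) : measurable (Z @^-1` (psi @^-1` [set k])).
  by apply: measurable_funPTI.
pose WA k : T -> \bar R := (fun x => (W x)%:E) \_ (Z @^-1` (psi @^-1` [set k])).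
have mWA k : measurable_fun [set: T] (WA k).
  apply/(measurable_restrictT _ (mA k)).1.
  by apply: measurable_funTS; exact/measurable_EFinP.
have WA0 k x : (0 <= WA k x)%E.
  by rewrite /WA /patch; case: ifPn => // _; rewrite lee_fin.
transitivity (\int[m]_x (\sum_(k \in range psi)
    k%:E * WA k x)%E)%E.
  apply: eq_integral => x _.
  rewrite EFinM (fimfunE psi) -fsumEFin// ge0_mule_fsuml; last first.
    by move=> k; rewrite nnfun_muleindic_ge0.
  apply: eq_fsbigr => k _.
  rewrite EFinM -muleA; congr (_ * _)%E.
  rewrite /WA /patch indicE; case: ifPn => h.
    by rewrite mem_set ?mul1e//; exact: (set_mem h).
  by rewrite memNset ?mul0e// => h'; move/negP: h; apply; exact: mem_set.
rewrite ge0_integral_fsum//; last 2 first.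
- by move=> k; exact: measurable_funeM.
- move=> k x _; have [k0|k0] := leP 0 k; first by rewrite mule_ge0.
  by rewrite /WA preimage_nnfun0// preimage_set0 patch_set0 mule0.
apply: eq_fsbigr => k _; have [k0|k0] := leP 0 k.
  by rewrite ge0_integralZl_EFin// [in RHS]integral_mkcond.
rewrite /WA preimage_nnfun0// preimage_set0 integral_set0 mule0 patch_set0.
by under eq_integral do rewrite mule0; rewrite integral0.
Qed.

(** If the image by [Z1] of the measure of density [W1] with respect to [m1]
    coincides with the image by [Z2] of the measure of density [W2] with respect
    to [m2], then every nonnegative measurable function has the same integral
    against both. *)
Lemma ge0_integral_comp_weight d1 d2 (T1 : measurableType d1)
    (T2 : measurableType d2) (R : realType)
    (m1 : {measure set T1 -> \bar R}) (m2 : {measure set T2 -> \bar R})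
    (Z1 : {mfun T1 >-> R}) (Z2 : {mfun T2 >-> R}) (W1 : T1 -> R) (W2 : T2 -> R)
    (phi : R -> R) :
  measurable_fun [set: T1] W1 -> (forall x, 0 <= W1 x) ->
  measurable_fun [set: T2] W2 -> (forall x, 0 <= W2 x) ->
  measurable_fun [set: R] phi -> (forall y, 0 <= phi y) ->
  (forall A, measurable A ->
     \int[m1]_(x in Z1 @^-1` A) (W1 x)%:E =
     \int[m2]_(x in Z2 @^-1` A) (W2 x)%:E)%E ->
  (\int[m1]_x (phi (Z1 x) * W1 x)%:E = \int[m2]_x (phi (Z2 x) * W2 x)%:E)%E.
Proof.
move=> mW1 W10 mW2 W20 mphi phi0 H.
have mphi' : measurable_fun [set: R] (EFin \o phi) by exact/measurable_EFinP.
pose psi := nnsfun_approx measurableT mphi'.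
(* Both sides are limits of integrals of the same simple functions. *)
have lim d (T : measurableType d) (m : {measure set T -> \bar R})
    (Z : {mfun T >-> R}) (W : T -> R) : measurable_fun [set: T] W ->
    (forall x, 0 <= W x) ->
    (\int[m]_x (phi (Z x) * W x)%:E =
     limn (fun n => \int[m]_x (psi n (Z x) * W x)%:E))%E.
  move=> mW W0; rewrite -monotone_convergence//.
  - apply: eq_integral => x _; apply/esym/cvg_lim => //.
    under eq_fun do rewrite EFinM muleC.
    rewrite EFinM muleC; apply: cvgeZl => //.
    by apply: cvg_nnsfun_approx => // y _; rewrite lee_fin.
  - move=> n; apply/measurable_EFinP; apply: measurable_funM => //.
    exact: measurableT_comp.
  - by move=> n x _; rewrite lee_fin mulr_ge0.
  - move=> x _ n k nk; rewrite lee_fin ler_wpM2r//.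
    exact/lefP/nd_nnsfun_approx.
rewrite !lim//; congr (limn _); apply/funext => n.
rewrite !integral_nnsfun_comp//; apply: eq_fsbigr => k _.
by rewrite H// -[X in measurable X]setTI; exact: measurable_funP.
Qed.

End weighted_integrals.

(** * Expectations of products of independent variables *)

(** The variables are treated one after the other: for the factors already
    treated the function [phi i] is used, for the others an arbitrary indicator,
    so that the induction hypothesis says that two measures coincide. *)
Lemma expectation_prod_indep d (Omega : measurableType d) (R : realType)
    (P : probability Omega R) (I : finType) (Z : I -> {RV P >-> R})
    (phi : I -> R -> R) :
  mutually_independent Z ->
  (forall i, measurable_fun [set: R] (phi i)) ->
  (forall i y, 0 <= phi i y) ->
  (forall i, \int[P]_w (phi i (Z i w))%:E < +oo)%E ->
  (\int[P]_w (\prod_i phi i (Z i w))%:E =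
   \prod_i \int[P]_w (phi i (Z i w))%:E)%E.
Proof.
move=> indep mphi phi0 phioo.
have PE E : measurable E -> (P E = \int[P]_w (\1_E w)%:E)%E.
  by move=> mE; rewrite integral_indic// setIT.
pose F (s : seq I) (A : I -> set R) (i : I) : R -> R :=
  if i \in s then phi i else \1_(A i).
suff H (s : seq I) (A : I -> set R) : (forall i, measurable (A i)) ->
    (\int[P]_w (\prod_i F s A i (Z i w))%:E =
     \prod_i \int[P]_w (F s A i (Z i w))%:E)%E.
  have := H (enum I) (fun=> setT) (fun=> measurableT).
  under eq_integral do under eq_bigr do rewrite /F mem_enum inE.
  by under [X in _ = X -> _]eq_bigr do
    under eq_integral do rewrite /F mem_enum inE.
have mF t B i : (forall i, measurable (B i)) ->
    measurable_fun [set: R] (F t B i).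
  by move=> mB; rewrite /F; case: ifP => _ //; exact: measurable_indic.
have F0 t B i y : 0 <= F t B i y by rewrite /F; case: ifP.
have Ffin t B i : (forall i, measurable (B i)) ->
    (\int[P]_w (F t B i (Z i w))%:E)%E \is a fin_num.
  move=> mB; rewrite ge0_fin_numE; last first.
    by apply: integral_ge0 => w _; rewrite lee_fin.
  rewrite /F; case: ifP => _ //.
  have mZ : measurable (Z i @^-1` B i) by exact: measurable_funPTI.
  by rewrite -(PE _ mZ) ltey_eq fin_num_measure.
elim: s A => [|i s IH] A mA.
  (* All the factors are indicators: this is the independence of events. *)
  transitivity
      (P (\bigcap_(i in [set i | i \in [set: I]%SET]) (Z i @^-1` A i))).
    rewrite PE.
      apply: eq_integral => w _; congr EFin.
      rewrite indicE; have [h|h] := boolP (w \in _).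
        apply: big1 => i _; rewrite /F in_nil indicE mem_set//.
        by apply: (set_mem h); rewrite /= inE.
      have [i iA] : exists i, ~ A i (Z i w).
        apply: contrapT => h'; move/negP: h; apply; apply: mem_set => i _ /=.
        by apply: contrapT => h''; apply: h'; exists i.
      by rewrite (bigD1 i)//= /F in_nil indicE memNset// mul0r.
    apply: fin_bigcap_measurable => // i _; exact: measurable_funPTI.
  rewrite indep//; apply: eq_big => [i|i _]; first by rewrite inE.
  by rewrite PE//; exact: measurable_funPTI.
have [si|si] := boolP (i \in s).
  have FE j : F (i :: s) A j = F s A j.
    by apply/funext => y; rewrite /F in_cons; case: eqVneq => // ->; rewrite si.
  under eq_integral do under eq_bigr do rewrite FE.
  by rewrite IH//; apply: eq_bigr => j _; under [RHS]eq_integral do rewrite FE.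
have Fi y : F (i :: s) A i y = phi i y by rewrite /F mem_head.
have Fj j : j != i -> F (i :: s) A j = F s A j.
  by move=> ji; apply/funext => y; rewrite /F in_cons (negPf ji).
pose W (w : Omega) : R := \prod_(j | j != i) F s A j (Z j w).
pose c : R := \prod_(j | j != i) fine (\int[P]_w (F s A j (Z j w))%:E)%E.
have c0 : 0 <= c.
  apply: prodr_ge0 => j _; apply/fine_ge0/integral_ge0 => w _.
  by rewrite lee_fin.
have W0 w : 0 <= W w by exact: prodr_ge0.
have mW : measurable_fun [set: Omega] W.
  rewrite /W; under eq_fun do rewrite -big_filter.
  apply: measurable_prod => j _.
  by apply: measurableT_comp => //; exact: mF.
have cE : c%:E = (\prod_(j | j != i) \int[P]_w (F s A j (Z j w))%:E)%E.
  by rewrite /c -prodEFin; apply: eq_bigr => j _; rewrite fineK// Ffin.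
have IHB B : measurable B -> (\int[P]_(w in Z i @^-1` B) (W w)%:E =
    \int[P]_(w in Z i @^-1` B) (c%:E))%E.
  move=> mB.
  have mZB : measurable (Z i @^-1` B) by exact: measurable_funPTI.
  pose A' j := if j == i then B else A j.
  have A'i : A' i = B by rewrite /A' eqxx.
  have FA'i : F s A' i = \1_B.
    by apply/funext => y; rewrite /F (negPf si) A'i.
  have FA' j : j != i -> F s A' j = F s A j.
    by move=> ji; apply/funext => y; rewrite /F /A' (negPf ji).
  have mA' j : measurable (A' j) by rewrite /A'; case: ifP.
  have := IH A' mA'.
  rewrite (bigD1 i)//= FA'i.
  rewrite (eq_bigr (fun j => \int[P]_w (F s A j (Z j w))%:E)%E); last first.
    by move=> j ji; under eq_integral do rewrite FA'//.
  rewrite -cE => e.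
  rewrite integral_cst// muleC.
  transitivity (\int[P]_w (\prod_j F s A' j (Z j w))%:E)%E.
    rewrite integral_mkcond; apply: eq_integral => w _.
    rewrite (bigD1 i)//= FA'i indicE.
    rewrite /patch; have [h|h] := boolP (w \in _).
      rewrite mem_set ?mul1r; last exact: (set_mem h).
      by congr EFin; apply: eq_bigr => j ji; rewrite FA'.
    rewrite memNset ?mul0r// => h'; move/negP: h; apply; exact: mem_set.
  rewrite e; congr (_ * _)%E.
  exact/esym/PE.
have := ge0_integral_comp_weight mW W0 (measurable_cst c) (fun=> c0) (mphi i)
  (phi0 i) IHB.
rewrite (bigD1 i)//= => e.
transitivity (\int[P]_w (phi i (Z i w) * W w)%:E)%E.
  apply: eq_integral => w _; rewrite (bigD1 i)//= Fi; congr (_ * _)%:E.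
  by apply: eq_bigr => j ji; rewrite Fj.
rewrite e.
under eq_integral do rewrite EFinM.
rewrite ge0_integralZr//; last 2 first.
- by apply/measurable_EFinP; exact: measurableT_comp.
- by move=> w _; rewrite lee_fin.
rewrite cE; congr (_ * _)%E; first by under [RHS]eq_integral do rewrite Fi.
by apply: eq_bigr => j ji; under [RHS]eq_integral do rewrite Fj//.
Qed.

(** * Hoeffding bounds on moment generating functions *)

Section bounded_variable.
Context d (Omega : measurableType d) (R : realType) (P : probability Omega R).
Context (Z : {RV P >-> R}) (B : R) (ZB : forall w, 0 <= Z w <= B).

Lemma bounded_integrable : P.-integrable [set: Omega] (EFin \o Z).
Proof.
apply: measurable_bounded_integrable => //.
  by rewrite (le_lt_trans (probability_le1 P measurableT)) ?ltry.
exists B; split; first exact: num_real.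
move=> x Bx w _ /=; have /andP[z0 zB] := ZB w.
by rewrite ger0_norm// (le_trans zB) ?ltW.
Qed.

Lemma bounded_expectation_fin_num : ('E_P[Z] \is a fin_num)%E.
Proof.
by rewrite unlock; apply: integrable_fin_num => //; exact: bounded_integrable.
Qed.

Lemma bounded_expectation_itv : 0 <= fine 'E_P[Z] <= B.
Proof.
have Z0 : (0 <= 'E_P[Z])%E.
  by apply: expectation_ge0 => w; have /andP[] := ZB w.
rewrite fine_ge0//= -lee_fin fineK ?bounded_expectation_fin_num//.
rewrite -(expectation_cst P B); apply: expectation_le => //.
- by move=> w; have /andP[] := ZB w.
- by move=> w; have /andP[z0 zB] := ZB w; exact: le_trans zB.
- by apply: aeW => w; have /andP[] := ZB w.
Qed.

(** Hoeffding's lemma: by convexity [expR (s * Z)] lies below the affine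
    function of [Z] with which it agrees at 0 and [B], and the expectation of
    the latter is that of a two-point variable. *)
Lemma hoeffding_mgf_le (s : R) :
  (\int[P]_w (expR (s * (Z w - fine 'E_P[Z])))%:E <=
   (expR (s ^+ 2 * B ^+ 2 / 8))%:E)%E.
Proof.
set m := fine 'E_P[Z].
have /andP[m0 mB] := bounded_expectation_itv.
(* When [B = 0], the value 0 of [B^-1] is harmless because then [Z = 0]. *)
pose beta := (expR (s * B) - 1) / B.
have sB (z : R) : 0 <= z <= B -> z = z / B * B.
  move=> /andP[z0 zB]; have [B0|B0] := eqVneq B 0; last by rewrite divfK.
  by rewrite B0 mulr0; apply: le_anti; rewrite z0 -B0 zB.
have itv01 (z : R) : 0 <= z <= B -> 0 <= z / B <= 1.
  move=> zB; have /andP[z0 z1] := zB.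
  rewrite divr_ge0//= ?(le_trans z0 z1)//.
  have [B0|B0] := eqVneq B 0; first by rewrite B0 invr0 mulr0.
  by rewrite ler_pdivrMr ?mul1r// lt_neqAle eq_sym B0 (le_trans z0 z1).
have le_aff w : expR (s * Z w) <= 1 + beta * Z w.
  rewrite [X in s * X](sB _ (ZB w)) mulrCA.
  apply: le_trans (expR_chord_le _ (itv01 _ (ZB w))) _.
  by rewrite /beta; lra.
have IE : (\int[P]_w (expR (- (s * m)) * (1 + beta * Z w))%:E =
    (expR (- (s * m)) * (1 + beta * m))%:E)%E.
  under eq_integral do rewrite mulrDr mulr1 mulrA EFinD EFinM.
  rewrite integralD//=; last 2 first.
  - exact: finite_measure_integrable_cst.
  - by apply: integrableZl => //; exact: bounded_integrable.
  rewrite integral_cst// integralZl//; last exact: bounded_integrable.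
  rewrite mulrDr mulr1 mulrA EFinD; congr (_ + _)%E.
    by rewrite -[RHS]mule1; congr (_ * _)%E; exact: probability_setT.
  rewrite [in RHS]EFinM; congr (_ * _)%E.
  by rewrite /m fineK ?bounded_expectation_fin_num// unlock.
apply: (@le_trans _ _ (\int[P]_w (expR (- (s * m)) * (1 + beta * Z w))%:E)%E).
  apply: ge0_le_integral => //.
  - apply/measurable_EFinP; apply: measurableT_comp => //.
    by apply: measurable_funM => //; exact: measurable_funB.
  - apply/measurable_EFinP; apply: measurable_funM => //.
    by apply: measurable_funD => //; exact: measurable_funM.
  - move=> w _; rewrite lee_fin mulrBr [s * Z w - _]addrC expRD.
    by rewrite ler_wpM2l ?expR_ge0.
rewrite IE lee_fin expRN mulrC ler_pdivrMr ?expR_gt0// -expRD.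
have := bernoulli_mgf_le (s * B) (itv01 _ (bounded_expectation_itv)).
rewrite -/m.
rewrite (_ : m / B * (s * B) = s * m); last first.
  by rewrite [in RHS](sB m) ?m0// mulrCA.
rewrite exprMn => h; rewrite [X in expR X]addrC; apply: le_trans h.
by rewrite /beta; lra.
Qed.

End bounded_variable.

Section bounded_independent_sum.
Context d (Omega : measurableType d) (R : realType) (P : probability Omega R).
Context (I : finType).
Implicit Types (Z : I -> {RV P >-> R}) (a : I -> R).

(** The weighted sum of the variables [Z i], each centered at its mean. *)
Definition centered_sum Z a (w : Omega) : R :=
  \sum_i a i * (Z i w - fine 'E_P[Z i]).

Lemma measurable_centered_sum Z a :
  measurable_fun [set: Omega] (centered_sum Z a).
Proof.
apply: measurable_sum => i; apply: measurable_funM => //.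
exact: measurable_funB.
Qed.

Lemma hoeffding_sum_mgf_le Z a (B t : R) :
  mutually_independent Z -> (forall i w, 0 <= Z i w <= B) ->
  (\int[P]_w (expR (t * centered_sum Z a w))%:E <=
   (expR (t ^+ 2 * (B ^+ 2 * \sum_i a i ^+ 2) / 8))%:E)%E.
Proof.
move=> indep ZB.
pose phi i (y : R) := expR (t * a i * (y - fine 'E_P[Z i])).
have le i := hoeffding_mgf_le (ZB i) (t * a i).
have -> : (\int[P]_w (expR (t * centered_sum Z a w))%:E =
    \int[P]_w (\prod_i phi i (Z i w))%:E)%E.
  apply: eq_integral => w _; congr EFin.
  rewrite /centered_sum mulr_sumr expR_sum.
  by apply: eq_bigr => i _; rewrite /phi mulrA.
rewrite expectation_prod_indep//.
- rewrite mulr_sumr mulr_sumr mulr_suml expR_sum -prodEFin.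
  suff : (0 <= \prod_i \int[P]_w (phi i (Z i w))%:E <=
      \prod_i (expR (t ^+ 2 * (B ^+ 2 * a i ^+ 2) / 8))%:E)%E.
    by case/andP.
  apply: (big_ind2 (fun x y : \bar R => 0 <= x <= y)%E).
  + by rewrite lexx lee01.
  + move=> x1 x2 y1 y2 /andP[x0 x12] /andP[y0 y12].
    by rewrite mule_ge0//= lee_pmul.
  + move=> i _; rewrite integral_ge0/=; last first.
      by move=> w _; rewrite lee_fin expR_ge0.
    apply: le_trans (le i) _; rewrite lee_fin ler_expR; lra.
- move=> i; apply: measurableT_comp => //; apply: measurable_funM => //.
  exact: measurable_funB.
- by move=> i y; exact: expR_ge0.
- by move=> i; apply: le_lt_trans (le i) _; rewrite ltry.
Qed.

End bounded_independent_sum.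

(** * Tail of the difference of two centered sums *)

(** No assumption is made on the joint law of [D1] and [D2]; convexity of the
    exponential replaces independence, at the price of doubling the variance
    proxy of an independent pair. *)
Lemma subgaussian_diff_tail d (Omega : measurableType d) (R : realType)
    (P : probability Omega R) (D1 D2 : Omega -> R) (V gamma : R) :
  measurable_fun [set: Omega] D1 -> measurable_fun [set: Omega] D2 ->
  (forall t, \int[P]_w (expR (t * D1 w))%:E <= (expR (t ^+ 2 * V / 8))%:E)%E ->
  (forall t, \int[P]_w (expR (t * D2 w))%:E <= (expR (t ^+ 2 * V / 8))%:E)%E ->
  0 < V -> 0 < gamma <= 1 ->
  with_probability_at_least P (1 - gamma)
    [set w | D1 w - D2 w <= Num.sqrt (2 * V * ln (1 / gamma))].
Proof.
move=> mD1 mD2 mgf1 mgf2 V0 /andP[g0 g1].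
have [->|gn1] := eqVneq gamma 1.
  (* An event of probability at least 0: the empty one. *)
  by exists set0; split => //; rewrite subrr measure0.
set L := ln (1 / gamma); set eps := Num.sqrt _.
have L0 : 0 < L by rewrite ln_gt0// ltr_pdivlMr// mul1r lt_neqAle gn1.
have eps0 : 0 < eps by rewrite sqrtr_gt0 !mulr_gt0.
have eps2 : eps ^+ 2 = 2 * V * L by rewrite sqr_sqrtr// !mulr_ge0// ltW.
have mX : measurable_fun [set: Omega] (D1 \- D2) by exact: measurable_funB.
pose X : {RV P >-> R} :=
  HB.pack (D1 \- D2) (isMeasurableFun.Build _ _ _ _ _ mX).
have mbad : measurable [set w | eps <= X w].
  rewrite (_ : [set w | _] = X @^-1` `[eps, +oo[); last first.
    by apply/seteqP; split => w /=; rewrite in_itv/= andbT.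
  exact: measurable_funPTI.
exists (~` [set w | eps <= X w]); split; first exact: measurableC.
- rewrite probability_setC// EFinB leeB//.
  (* The minimizer of [t ^+ 2 * V / 2 - t * eps]. *)
  pose t := eps / V.
  have t0 : 0 < t by rewrite divr_gt0.
  apply: le_trans (chernoff X eps t0) _.
  have -> : gamma%:E = ((expR (t ^+ 2 * V / 2))%:E * (expR (- (t * eps)))%:E)%E.
    rewrite -EFinM -expRD (_ : _ + _ = - L).
      by rewrite expRN lnK ?posrE ?divr_gt0// div1r invrK.
    have -> : t ^+ 2 * V / 2 + - (t * eps) = - (eps ^+ 2 / (2 * V)).
      by rewrite /t; field; rewrite gt_eqF.
    by rewrite eps2; field; rewrite gt_eqF.
  rewrite lee_pmul2r ?lte_fin ?expR_gt0// /mmt_gen_fun unlock.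
  have mE (s : R) (D : Omega -> R) : measurable_fun [set: Omega] D ->
      measurable_fun [set: Omega] (fun w => (expR (s * D w))%:E).
    move=> mD; apply/measurable_EFinP; apply: measurableT_comp => //.
    exact: measurable_funM.
  have -> : (expR (t ^+ 2 * V / 2))%:E =
      (2^-1%:E * ((expR (t ^+ 2 * V / 2))%:E + (expR (t ^+ 2 * V / 2))%:E))%E.
    by rewrite -EFinD -EFinM; congr EFin; field.
  apply: (@le_trans _ _ (\int[P]_w (2^-1%:E *
     ((expR (2 * t * D1 w))%:E + (expR (- (2 * t) * D2 w))%:E)))%E).
    apply: ge0_le_integral => //.
    + by move=> w _; rewrite lee_fin expR_ge0.
    + apply/measurable_EFinP; apply: measurableT_comp => //=.
      exact: measurable_funM.
    + by apply: measurable_funeM; apply: emeasurable_funD; exact: mE.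
    + move=> w _; rewrite -EFinD -EFinM lee_fin /=.
      have -> : expR ((D1 w - D2 w) * t) =
          expR (t * D1 w) * expR (- (t * D2 w)).
        by rewrite -expRD; congr expR; ring.
      have -> : expR (2 * t * D1 w) = expR (t * D1 w) ^+ 2.
        by rewrite -expRM_natl; congr expR; ring.
      have -> : expR (- (2 * t) * D2 w) = expR (- (t * D2 w)) ^+ 2.
        by rewrite -expRM_natl; congr expR; ring.
      have := sqr_ge0 (expR (t * D1 w) - expR (- (t * D2 w))).
      by move=> h; rewrite -subr_ge0; lra.
  rewrite ge0_integralZl_EFin//; last 2 first.
    by move=> w _; rewrite adde_ge0// lee_fin expR_ge0.
    by apply: emeasurable_funD; exact: mE.
  rewrite lee_pmul2l// ge0_integralD//; last 2 first.
  - exact: mE.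
  - exact: mE.
  apply: leeD.
    by apply: le_trans (mgf1 _) _; rewrite lee_fin ler_expR; lra.
  by apply: le_trans (mgf2 _) _; rewrite lee_fin ler_expR; lra.
- by move=> w /= /negP; rewrite -ltNge => /ltW.
Qed.

Lemma hoeffding_diff_tail d (Omega : measurableType d) (R : realType)
    (P : probability Omega R) (I : finType) (Z1 Z2 : I -> {RV P >-> R})
    (a : I -> R) (B gamma : R) :
  mutually_independent Z1 -> mutually_independent Z2 ->
  (forall i w, 0 <= Z1 i w <= B) -> (forall i w, 0 <= Z2 i w <= B) ->
  0 < gamma <= 1 ->
  with_probability_at_least P (1 - gamma)
    [set w | centered_sum Z1 a w - centered_sum Z2 a w <=
             Num.sqrt (2 * (B ^+ 2 * \sum_i a i ^+ 2) * ln (1 / gamma))].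
Proof.
move=> ind1 ind2 Z1B Z2B hgamma.
have V0 : 0 <= B ^+ 2 * \sum_i a i ^+ 2.
  by rewrite mulr_ge0 ?sqr_ge0// sumr_ge0// => i _; exact: sqr_ge0.
(* If the variance proxy vanishes, then so do both sums. *)
move: V0; rewrite le_eqVlt => /predU1P[V0|V0]; last first.
  by apply: subgaussian_diff_tail => // [||t|t];
    [exact: measurable_centered_sum|exact: measurable_centered_sum|
     exact: hoeffding_sum_mgf_le|exact: hoeffding_sum_mgf_le].
have centered0 (Z : I -> {RV P >-> R}) w :
    (forall i w, 0 <= Z i w <= B) -> centered_sum Z a w = 0.
  move=> ZB; apply: big1 => i _; apply/eqP; rewrite mulf_eq0.
  move/esym/eqP: V0; rewrite mulf_eq0 sqrf_eq0 => /orP[/eqP B0|].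
    have /andP[m0 mB] := bounded_expectation_itv (ZB i).
    have /andP[z0 zB] := ZB i w.
    by apply/orP; right; rewrite subr_eq0; apply/eqP; lra.
  rewrite psumr_eq0; last by move=> j _; exact: sqr_ge0.
  by move=> /allP/(_ i); rewrite mem_index_enum sqrf_eq0 /= => ->.
have /andP[/ltW g0 _] := hgamma.
exists setT; split => //; first by rewrite probability_setT lee_fin gerBl.
by move=> w _ /=; rewrite !centered0// subrr sqrtr_ge0.
Qed.

(** * Mean of a density *)

(** The positive and the negative parts are compared separately, so no
    integrability is needed. *)
Lemma density_mean_expectation d (Omega : measurableType d) (R : realType)
    (P : probability Omega R) (Z : {RV P >-> R}) (e : R -> R) :
  is_density e -> has_density Z e -> density_mean e = ('E_P[Z])%E.
Proof.
move=> [me e0 _] Ze.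
have mid : measurable_fun [set: measurableTypeR R]
    (fun y : measurableTypeR R => y : R).
  exact: measurable_id.
pose idm : {mfun measurableTypeR R >-> R} :=
  HB.pack (fun y : measurableTypeR R => y : R)
    (isMeasurableFun.Build _ _ _ _ _ mid).
have tr (phi : R -> R) :
    measurable_fun [set: R] phi -> (forall y, 0 <= phi y) ->
    (\int[P]_w (phi (Z w))%:E =
     \int[lebesgue_measure]_(y in [set: R]) (phi y * e y)%:E)%E.
  move=> mphi phi0.
  rewrite -(@ge0_integral_comp_weight _ _ _ _ _ P lebesgue_measure Z idm
    (cst 1) e phi)//.
    by apply: eq_integral => w _; rewrite mulr1.
  move=> A mA; have /= <- := Ze A mA.
  rewrite integral_cst ?mul1e//; exact: measurable_funPTI.
rewrite /density_mean unlock integralE [in RHS]integralE; congr (_ - _)%E.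
- rewrite [RHS](_ : _ = \int[P]_w (Num.max (Z w) 0)%:E)%E; last first.
    by apply: eq_integral => w _; rewrite funeposE EFin_max.
  rewrite (tr (fun y => Num.max y 0)); last 2 first.
  + exact: measurable_maxr.
  + by move=> y; rewrite le_max lexx orbT.
  apply: eq_integral => y _; rewrite funeposE -EFin_max; congr EFin.
  by rewrite maxr_pMl// mul0r.
- rewrite [RHS](_ : _ = \int[P]_w (Num.max (- Z w) 0)%:E)%E; last first.
    by apply: eq_integral => w _; rewrite funenegE EFin_max.
  rewrite (tr (fun y => Num.max (- y) 0)); last 2 first.
  + by apply: measurable_maxr => //; exact: measurable_funN.
  + by move=> y; rewrite le_max lexx orbT.
  apply: eq_integral => y _; rewrite funenegE -EFin_max; congr EFin.
  by rewrite maxr_pMl// mul0r mulNr.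
Qed.

(** * Sums over nearest neighbors *)

Section nearest_neighbor_sums.
Context (R : realType) (S : finType) (q : S -> R) (T : {set S}) (nu : S -> S).
Context (q0 : forall s, 0 <= q s) (nuT : forall s, s \notin T -> nu s \in T).

Lemma Qbar_ge0 : 0 <= Qbar q T.
Proof. exact: bigmax_ge_id. Qed.

Lemma le_Qbar s : s \notin T -> q s <= Qbar q T.
Proof. by move=> sT; apply: le_bigmax_cond; rewrite inE. Qed.

Lemma sum_nearest_neighbor (c v : S -> R) :
  \sum_(s in ~: T) c s * v (nu s) =
  \sum_(t in T) (\sum_(s in ~: T | nu s == t) c s) * v t.
Proof.
rewrite (partition_big nu (mem T))/=; last by move=> s; rewrite inE => /nuT.
apply: eq_bigr => t _; rewrite mulr_suml; apply: eq_bigr => s /andP[_].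
by move=> /eqP ->.
Qed.

Lemma sum_assigned (v : S -> R) :
  \sum_(s in ~: T) v (nu s) = \sum_(t in T) (assigned T nu t)%:R * v t.
Proof.
rewrite (eq_bigr (fun s => 1 * v (nu s))); last by move=> s _; rewrite mul1r.
rewrite (sum_nearest_neighbor (fun=> 1)); apply: eq_bigr => t _; congr (_ * _).
rewrite /assigned natr_sum [LHS]big_mkcondr; apply: eq_bigr => s _.
by case: eqP.
Qed.

(** The weight of follower [s] in [\sum_(s in ~: T) q s * (v s - v (nu s))], see
    [sum_residual_weight]. *)
Definition residual_weight (s : S) : R :=
  if s \in T then - \sum_(u in ~: T | nu u == s) q u else q s.

Lemma sum_residual_weight (v : S -> R) :
  \sum_s residual_weight s * v s = \sum_(s in ~: T) q s * (v s - v (nu s)).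
Proof.
rewrite (bigID (mem T))/= addrC.
under [RHS]eq_bigr do rewrite mulrBr.
rewrite sumrB sum_nearest_neighbor; congr (_ + _).
  rewrite [RHS](eq_bigl (fun s => s \notin T)); last by move=> s; rewrite inE.
  by apply: eq_bigr => s sT; rewrite /residual_weight (negPf sT).
rewrite -sumrN; apply: eq_bigr => t tT.
by rewrite /residual_weight tT mulNr.
Qed.

Lemma sum_sqr_residual_weight_le :
  \sum_s residual_weight s ^+ 2 <=
  Qbar q T ^+ 2 * (#|~: T|%:R + \sum_(t in T) (assigned T nu t)%:R ^+ 2).
Proof.
rewrite (bigID (mem T))/= addrC mulrDr; apply: lerD.
  rewrite (eq_bigl (fun s => s \in ~: T)); last by move=> s; rewrite inE.
  rewrite mulr_natr -sumr_const; apply: ler_sum => s; rewrite inE => sT.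
  by rewrite /residual_weight (negPf sT) ler_sqr ?nnegrE ?q0 ?Qbar_ge0 ?le_Qbar.
rewrite mulr_sumr; apply: ler_sum => t tT.
rewrite /residual_weight tT sqrrN -exprMn ler_sqr ?nnegrE; last 2 first.
- by apply: sumr_ge0.
- by rewrite mulr_ge0 ?Qbar_ge0.
rewrite /assigned natr_sum mulr_sumr big_mkcondr/=; apply: ler_sum => s.
rewrite inE => sT; case: eqP => _; first by rewrite mulr1 le_Qbar.
by rewrite mulr0.
Qed.

(** Here [v] stands for the costs at some decision, [p] for the predictions, [m]
    for the expected costs, and [dist s] for the distance from [s] to [nu s]. *)
Lemma regression_gap_le (v p m dist : S -> R) (lambda mu L : R) :
  (forall s, s \notin T -> `|m s - m (nu s)| <= mu * dist s) ->
  (forall s, s \notin T -> `|p s - p (nu s)| <= lambda * dist s) ->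
  \sum_(t in T) (assigned T nu t)%:R * `|v t - p t| <= L ->
  `|\sum_(s in ~: T) q s * (v s - p s) -
    \sum_s residual_weight s * (v s - m s)| <=
  Qbar q T * L + Qbar q T * (lambda + mu) * \sum_(s in ~: T) dist s.
Proof.
move=> hm hp hL.
rewrite sum_residual_weight -sumrB.
apply: le_trans (ler_norm_sum _ _ _) _.
apply: (@le_trans _ _ (\sum_(s in ~: T) (Qbar q T * `|v (nu s) - p (nu s)| +
    Qbar q T * (lambda + mu) * dist s))).
  apply: ler_sum => s; rewrite inE => sT.
  rewrite -mulrBr normrM (ger0_norm (q0 s)) -mulrA -mulrDr.
  apply: ler_pM => //; first exact: le_Qbar.
  rewrite (_ : _ - _ =
      (v (nu s) - p (nu s)) + (m s - m (nu s)) - (p s - p (nu s))); last first.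
    by ring.
  have h1 := hm _ sT; have h2 := hp _ sT.
  apply: le_trans (ler_normB _ _) _.
  apply: le_trans (lerD (ler_normD _ _) (lexx _)) _.
  by rewrite mulrDl -addrA lerD2l addrC lerD.
rewrite big_split/= -!mulr_sumr lerD2r ler_wpM2l ?Qbar_ge0//.
by rewrite (sum_assigned (fun t => `|v t - p t|)).
Qed.

End nearest_neighbor_sums.

(** * The performance guarantee *)

Theorem theorem2 (R : realType) (n1 n2 xi : nat)
  (* randomness *)
  (d : measure_display) (Omega : measurableType d) (P : probability Omega R)
  (* leader *)
  (X : set 'rV[R]_n1) (f : 'rV[R]_n1 -> R)
  (hXb : bounded_set X) (hXc : closed X)
  (* followers; [h s w] and [Y s w] are the realizations of h^s and Y^s *)
  (S : finType) (q : S -> R) (hq : forall s, 0 <= q s)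
  (g : 'rV[R]_(n1 + n2) -> R) (hg : forall z, 0 <= g z)
  (h : S -> Omega -> 'rV[R]_(n1 + n2) -> R)
  (Y : S -> Omega -> 'rV[R]_n1 -> set 'rV[R]_n2)
  (hY : forall s w x, X x -> Y s w x !=set0)
  (G : S -> 'rV[R]_n1 -> {RV P >-> R})
  (hG : forall s w x, X x -> is_follower_cost g (h s w) (Y s w) x (G s x w))
  (Gbar : R) (hGbar0 : 0 <= Gbar)
  (hGbar : forall s w x, X x -> 0 <= G s x w <= Gbar)
  (* features and conditional densities *)
  (FS : set 'rV[R]_xi) (dF : 'rV[R]_xi -> 'rV[R]_xi -> R)
  (hdF : is_metric_on FS dF)
  (phi : S -> 'rV[R]_xi) (hphi : forall s, FS (phi s))
  (eta : 'rV[R]_n1 -> 'rV[R]_xi -> R -> R)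
  (heta : forall x u, X x -> FS u -> is_density (eta x u))
  (hlaw : forall s x, X x -> has_density (G s x) (eta x (phi s)))
  (* regression model *)
  (Par : Type) (Theta : set Par) (M : 'rV[R]_xi -> Par -> R)
  (Lbar : R) (hLbar : 0 <= Lbar)
  (* (A1) *)
  (A1 : forall x : S -> 'rV[R]_n1, (forall s, X (x s)) ->
     mutually_independent (fun s => G s (x s)))
  (* (A2) *)
  (mu : R) (hmu : 0 <= mu)
  (A2 : forall x, X x ->
     elipschitz_wrt FS dF mu (fun u => density_mean (eta x u)))
  (* (A3) *)
  (lambda : R) (hlambda : 0 <= lambda)
  (A3 : forall theta, Theta theta ->
     lipschitz_wrt FS dF lambda (fun u => M u theta))
  (* sample and nearest neighbors *)
  (T : {set S}) (hT : T != finset.set0)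
  (nu : S -> S) (hnu : is_nearest_neighbor dF phi T nu)
  (* fixed leader decisions; whether they solve the two problems depends on the
     realization [w] of the costs *)
  (xPR xopt : 'rV[R]_n1) (hxPR : X xPR) (hxopt : X xopt)
  (gamma : R) (hgamma : 0 < gamma <= 1) :
  with_probability_at_least P (1 - gamma)
    [set w |
       let Gw := fun s x => G s x w in
       let F := original_objective f q Gw in
       pr_solution f q phi T nu M X Theta Lbar Gw xPR ->
       argmin X F xopt ->
       (exists theta,
          pr_feasible phi T nu M X Theta Lbar Gw (xopt, theta)) ->
       F xPR - F xopt <= pr_bound q phi T nu dF lambda mu Lbar Gbar gamma].


Proof.
have nuT s : s \notin T -> nu s \in T by move=> /hnu[].
have dnu0 s : 0 <= dF (phi s) (phi (nu s)) by case: hdF => + _ _ _; exact.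
set a := residual_weight q T nu.
pose mean x s := fine 'E_P[G s x]%E.
have mean_lip x : X x ->
    forall s, `|mean x s - mean x (nu s)| <= mu * dF (phi s) (phi (nu s)).
  move=> Xx s; rewrite -lee_fin.
  have fin t : ('E_P[G t x] \is a fin_num)%E.
    by apply: (@bounded_expectation_fin_num _ _ _ _ _ Gbar) => w; exact: hGbar.
  have dm t : density_mean (eta x (phi t)) = 'E_P[G t x]%E.
    by apply: density_mean_expectation; [exact: heta|exact: hlaw].
  have := A2 _ Xx _ _ (hphi s) (hphi (nu s)); rewrite !dm.
  by rewrite -(fineK (fin s)) -(fineK (fin (nu s))) -EFinB.
have gap w x theta :
    pr_feasible phi T nu M X Theta Lbar (fun s x => G s x w) (x, theta) ->
    `|\sum_(s in ~: T) q s * (G s x w - M (phi s) theta)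
      - centered_sum (fun s => G s x) a w| <=
    Qbar q T * Lbar + Qbar q T * (lambda + mu) *
      \sum_(s in ~: T) dF (phi s) (phi (nu s)).
  move=> [/= Xx Th loss].
  apply: (@regression_gap_le _ _ _ _ _ hq nuT (fun s => G s x w)
    (fun s => M (phi s) theta) (mean x)) => // s sT.
  - exact: mean_lip.
  - exact: A3.
have [A [mA PA goodA]] := @hoeffding_diff_tail _ _ _ _ _ (fun s => G s xPR)
  (fun s => G s xopt) a Gbar gamma (A1 (fun=> xPR) (fun=> hxPR))
  (A1 (fun=> xopt) (fun=> hxopt)) (fun s w => hGbar s w xPR hxPR)
  (fun s w => hGbar s w xopt hxopt) hgamma.
exists A; split => // w Aw Gw F [thetaPR [feasPR optPR]] _ [theta feas].
have gap1 := gap _ _ _ feasPR; have gap2 := gap _ _ _ feas.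
have /= dev := goodA _ Aw.
have /= obj := optPR _ feas; rewrite /pr_objective/= in obj.
have split_obj x th : F x = f x + \sum_(t in T) q t * Gw t x
    + \sum_(s in ~: T) q s * M (phi s) th
    + \sum_(s in ~: T) q s * (Gw s x - M (phi s) th).
  rewrite /F /original_objective (bigID (mem T))/= -!addrA; congr (_ + (_ + _)).
  rewrite -big_split/= (eq_bigl (fun s => s \in ~: T)); last first.
    by move=> s; rewrite inE.
  by apply: eq_bigr => s _; ring.
have tail : Num.sqrt (2 * (Gbar ^+ 2 * \sum_s a s ^+ 2) * ln (1 / gamma)) <=
    Num.sqrt (4 * Qbar q T ^+ 2 * Gbar ^+ 2
              * (#|~: T|%:R + \sum_(t in T) (assigned T nu t)%:R ^+ 2)
              * ln (1 / gamma)).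
  have /andP[g0 g1] := hgamma.
  rewrite ler_wsqrtr// ler_wpM2r ?ln_ge0 ?ler_pdivlMr ?mul1r//.
  have a2 := sum_sqr_residual_weight_le T nu hq; rewrite -/a in a2.
  have {}a2 := ler_wpM2l (sqr_ge0 Gbar) a2.
  have V0 : 0 <= Gbar ^+ 2 * \sum_s a s ^+ 2.
    by rewrite mulr_ge0 ?sqr_ge0// sumr_ge0// => s _; exact: sqr_ge0.
  by lra.
(* If no follower is left outside [T], then [Qbar] is 0. *)
have QL : Qbar q T * Lbar * (T \proper [set: S])%:R = Qbar q T * Lbar.
  have [TS|TS] := boolP (T \proper [set: S]); first by rewrite mulr1.
  rewrite mulr0 /Qbar big_pred0 ?mul0r// => s; rewrite inE.
  apply: contraNF TS => sT; apply/properP; split.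
    by apply/fintype.subsetP => t _; exact: in_setT.
  by exists s; rewrite ?sT //; exact: in_setT.
rewrite /pr_bound -!(mulrA 2) QL (split_obj xPR thetaPR) (split_obj xopt theta).
move: gap1 gap2; rewrite !ler_norml => /andP[_ gap1] /andP[gap2 _].
rewrite -/Gw in obj gap1 gap2 dev *.
lra.
Qed.
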